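(* Let $F\in\mathbf{AF}$ be isomorphic to the Fraïssé quiver and let $Q\in\mathbf{AF}$ be arbitrary. Then there exists $\mathbf i=(i_1,i_2,\dots)\in\mathbb{N}^{\mathbb{N}}$ such that the sequence $(\mu_{i_m}\circ\cdots\circ\mu_{i_1}(F))_{m\ge1}$ converges to $Q$ in $\mathbf{AF}$.
   Context: $\mathbb{N}$ is the positive integers. A quiver on a set $X$ is a function $Q:X\times X\to\mathbb{Z}$ with $Q(x,y)=-Q(y,x)$. $\mathbf{AF}$ is the set of quivers on $\mathbb{N}$ with the topology generated by the basic sets $U_{Q,V}=\{Q':Q'(x,y)=Q(x,y)\text{ for all }x,y\in V\}$, $V\subseteq\mathbb{N}$ finite. Mutation at $x$: $\mu_x(Q)(v,w)=-Q(v,w)$ if $x\in\{v,w\}$, otherwise $Q(v,w)+Q(v,x)[Q(x,w)]_++[-Q(v,x)]_+Q(x,w)$, $[a]_+=\max(a,0)$. A quiver $Q$ is homogeneous if every isomorphism between full subquivers (restrictions of $Q$ to vertex subsets) on finite vertex sets extends to an automorphism of $Q$. The Fraïssé quiver is the unique (up to isomorphism) countable homogeneous quiver into which every quiver on a finite vertex set embeds as a full subquiver (the Fraïssé limit of the class of all quivers on finite vertex sets). *)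

(* Defs.v *)
From HB Require Import structures.
From mathcomp Require Import all_boot all_order all_algebra finmap.
From mathcomp Require Import mathcomp_extra boolp classical_sets functions.
From mathcomp Require Import topology.

Set Implicit Arguments.
Unset Strict Implicit.
Unset Printing Implicit Defensive.

Import Order.TTheory GRing.Theory Num.Theory.
Local Open Scope ring_scope.
Local Open Scope classical_set_scope.

Record quiver (X : Type) := Quiver {
  arrows :> X -> X -> int;
  arrows_skew : forall x y, arrows x y = - arrows y x }.

Section mutation.
Variables (X : eqType) (x : X) (Q : quiver X).

Definition pos_part (a : int) : int := Num.max a 0.

Definition mutation_arrows (v w : X) : int :=
  if (x == v) || (x == w) then - Q v w
  else Q v w + Q v x * pos_part (Q x w) + pos_part (- Q v x) * Q x w.

Lemma mutation_skew v w : mutation_arrows v w = - mutation_arrows w v.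
Proof.
rewrite /mutation_arrows orbC (arrows_skew Q v w); case: ifP => // _.
rewrite (arrows_skew Q v x) (arrows_skew Q x w) !opprK !opprD !mulNr !mulrN.
by rewrite -!addrA; congr (_ + _); rewrite addrC ![_ * pos_part _]mulrC.
Qed.

Definition mutation : quiver X := Quiver mutation_skew.
End mutation.

Section restriction.
Variables (X : choiceType) (Q : quiver X) (V : {fset X}).

Lemma restrict_skew (x y : V) : Q (val x) (val y) = - Q (val y) (val x).
Proof. exact: arrows_skew. Qed.

Definition restrict : quiver V := Quiver restrict_skew.
End restriction.

Definition is_iso (X Y : Type) (P : quiver X) (Q : quiver Y) (f : X -> Y) :=
  bijective f /\ forall x y, Q (f x) (f y) = P x y.

Definition isomorphic (X Y : Type) (P : quiver X) (Q : quiver Y) :=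
  exists f : X -> Y, is_iso P Q f.

Definition homogeneous (X : choiceType) (Q : quiver X) :=
  forall (V W : {fset X}) (f : V -> W), is_iso (restrict Q V) (restrict Q W) f ->
    exists2 g : X -> X, is_iso Q Q g & forall x : V, g (val x) = val (f x).

Definition embeds (X Y : Type) (P : quiver X) (Q : quiver Y) :=
  exists2 f : X -> Y, injective f & forall x y, Q (f x) (f y) = P x y.

(* Characterizes the Fraisse limit of the finite quivers up to isomorphism. *)
Definition is_fraisse (X : countType) (G : quiver X) :=
  homogeneous G /\ forall (T : finType) (P : quiver T), embeds P G.

(* The countable vertex set is [nat]: the positive integer [n.+1] is encoded
   by [n]. Only equality of vertices is ever used. *)
Definition AF : Type := quiver nat.

Definition AF_basic (Q : AF) (V : {fset nat}) : set AF :=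
  [set Q' | forall x y, x \in V -> y \in V -> Q' x y = Q x y].

Definition AF_base : set (set AF) :=
  [set U | exists Q V, U = AF_basic Q V].

Lemma AF_base_cover : \bigcup_(U in AF_base) id U = setT.
Proof.
apply/seteqP; split=> // Q _; exists (AF_basic Q fset0) => //.
by exists Q, fset0.
Qed.

Lemma AF_base_join (U U' : set AF) (Q : AF) :
  AF_base U -> AF_base U' -> id U Q -> id U' Q ->
  exists W, [/\ AF_base W, id W Q & id W `<=` id U `&` id U'].
Proof.
move=> [P [V ->]] [P' [V' ->]] QP QP'.
exists (AF_basic Q (V `|` V')%fset); split=> //; first by exists Q, (V `|` V')%fset.
move=> R RQ; split=> x y xV yV.
  by rewrite RQ ?QP // inE ?xV ?yV.
by rewrite RQ ?QP' // inE ?xV ?yV orbT.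
Qed.

HB.instance Definition _ := gen_eqMixin AF.
HB.instance Definition _ := gen_choiceMixin AF.
HB.instance Definition _ :=
  isBaseTopological.Build AF AF_base_cover AF_base_join.

(* [mutate_seq i m Q] is mu_(i (m-1)) (... (mu_(i 0) Q)). *)
Fixpoint mutate_seq (i : nat -> nat) (m : nat) (Q : AF) : AF :=
  if m is k.+1 then mutation (i k) (mutate_seq i k Q) else Q.

(* Main.v *)
(** The Fraisse quiver has vertices outside any finite set with arbitrarily
    prescribed arrows to it, and mutation preserves this property. Columns
    [n = 0, 1, ...] are corrected one after the other: mutating at a vertex [x]
    whose arrows to [0, n) all have the same sign does not change the arrows
    inside [0, n), and if there is one arrow between [x] and [n], it adds the
    multiplicities of the others to the arrows between [0, n) and [n]. Hence two
    mutations suffice for column [n]: the [2n]-th one raises the entries which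
    are too small, the [2n+1]-st one lowers those which are too large. *)

Require Import Defs.
From mathcomp Require Import all_boot all_order all_algebra finmap.
From mathcomp Require Import boolp classical_sets functions topology.
From mathcomp Require Import ring zify.

Local Open Scope classical_set_scope.

Import Order.TTheory GRing.Theory Num.Theory.

Lemma arrows_diag (X : Type) (P : quiver X) (x : X) : P x x = 0%R.
Proof. by have := arrows_skew P x x; lia. Qed.

Section one_point_extension.
Variables (X : choiceType) (G : quiver X) (V : {fset X}) (a : X -> int).
Local Open Scope ring_scope.

Definition one_point_arrows (u v : option V) : int :=
  match u, v with
  | Some u, Some v => G (val u) (val v)
  | Some u, None => a (val u)
  | None, Some v => - a (val v)
  | None, None => 0
  end.

Lemma one_point_skew u v : one_point_arrows u v = - one_point_arrows v u.
Proof.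
by case: u v => [u|] [v|] //=; rewrite ?opprK ?oppr0 //; exact: arrows_skew.
Qed.

Definition one_point_extension : quiver (option V) := Quiver one_point_skew.
End one_point_extension.

(** Universality embeds the one-point extension by [e]. Homogeneity extends the isomorphism from [V]
    to its copy to an automorphism [g], whose inverse carries the copy back onto [V] and [e None] to
    the required vertex. *)
Lemma fraisse_extension (X : countType) (G : quiver X) (V : {fset X})
    (a : X -> int) :
  is_fraisse G ->
  exists2 z : X, z \notin V & forall v, v \in V -> G v z = a v.
Proof.
move=> [homG univG].
have [e e_inj eG] := univG _ (one_point_extension _ G V a).
pose W := [fset e (Some v) | v : V]%fset.
have eW (v : V) : e (Some v) \in W by apply/imfsetP; exists v.
pose f (v : V) : W := [` eW v]%fset.
have f_inj : injective f by move=> u v /(congr1 val) /= /e_inj [].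
have f_bij : bijective f.
  apply: inj_card_bij => //; rewrite -(cardfE W).
  by rewrite (leq_trans (leq_imfset_card _ _ _)) // cardE.
have [|g [[h gK hK] gG] ge] := homG V W f.
  by split=> // u v; rewrite /= (eG (Some u) (Some v)).
exists (h (e None)) => [|v vV].
  apply/negP => zV; have := ge [` zV]%fset.
  by rewrite /= hK => /e_inj.
by rewrite -gG hK (ge [` vV]%fset) /= (eG (Some _) None).
Qed.

Definition column_extension (P : AF) :=
  forall (n : nat) (a : nat -> int),
    exists2 z, n <= z & forall v, v < n -> P v z = a v.

Lemma isomorphic_fraisse_column_extension (X : countType) (G : quiver X)
    (F : AF) :
  is_fraisse G -> isomorphic F G -> column_extension F.
Proof.
move=> hG [f [[g fK gK] fG]] n a.
pose V := [fset f v | v in iota 0 n]%fset.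
have fV v : v < n -> f v \in V.
  by move=> vn; apply/imfsetP; exists v => //=; rewrite mem_iota.
have [z zV zG] := fraisse_extension _ _ V (a \o g) hG.
exists (g z) => [|v vn].
  by rewrite leqNgt; apply: contra zV => /fV; rewrite gK.
by rewrite -fG gK zG ?fV //= fK.
Qed.

Local Open Scope ring_scope.

Lemma mutation_column_extension (P : AF) (x : nat) :
  column_extension P -> column_extension (mutation x P).
Proof.
move=> extP n a.
(* The prescription [a] mutated at [x]: mutation is an involution. *)
pose b v := if v == x then - a x
  else a v - P v x * pos_part (- a x) + pos_part (- P v x) * a x.
(* The bound [x.+1] prescribes the arrow from [x] as well and forces [z] to differ from [x]. *)
have [z lez Pz] := extP (maxn n x.+1) b.
exists z => [|v vn]; first by lia.
have Pxz : P x z = - a x by rewrite Pz /b ?eqxx //; lia.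
rewrite /= /mutation_arrows (_ : (x == z) = false) ?orbF; last by lia.
have [<-|xv] := eqVneq x v; first by rewrite Pxz opprK.
rewrite Pxz Pz; last by lia.
by rewrite /b ifN_eqC //; ring.
Qed.

Lemma mutation_column_step (Q P : AF) (m : nat) :
  column_extension P ->
  exists x : nat,
    (forall v w, (v < w < m./2)%N -> mutation x P v w = P v w) /\
    (forall v, (v < m./2)%N -> mutation x P v m./2 =
       if odd m then Num.min (P v m./2) (Q v m./2)
       else Num.max (P v m./2) (Q v m./2)).
Proof.
set n := m./2 => extP.
pose d v := Q v n - P v n.
(* The single arrow is [x -> n] for even [m] and [n -> x] for odd [m]. Paths [v -> x -> n] then add
   the positive part of [d v], and paths [n -> x -> v] add its negative part. *)
pose a v : int := if v == n then (if odd m then 1 else -1)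
  else if odd m then Num.min (d v) 0 else Num.max (d v) 0.
have [x nx Px] := extP n.+1 a.
have Px' v : (v <= n)%N -> P x v = - a v.
  by move=> vn; rewrite arrows_skew Px.
exists x; split=> [v w /andP[vw wn]|v vn]; rewrite /= /mutation_arrows.
  rewrite ifF ?Px ?Px' /a; [|lia..].
  rewrite /pos_part !ifN_eq; [|lia..].
  (* No path [v -> x -> w] or [w -> x -> v] exists below [n]: the two correction terms cancel for
     odd [m] and both vanish for even [m]. *)
  case: (odd m).
    have min0 u : Num.max (- Num.min (d u) 0) 0 = - Num.min (d u) 0 by lia.
    by rewrite !min0; ring.
  have max0 u : Num.max (- Num.max (d u) 0) 0 = 0 by lia.
  by rewrite !max0; ring.
rewrite ifF ?Px ?Px' /a; [|lia..].
rewrite eqxx /pos_part ifN_eq; last lia.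
rewrite /d; case: (odd m).
  by rewrite (_ : Num.max (-1) 0 = 0 :> int) //; move: (P v n) (Q v n) => p q; lia.
by rewrite opprK (_ : Num.max 1 0 = 1 :> int) //; move: (P v n) (Q v n) => p q; lia.
Qed.

(** A finite vertex set lies in some [[0, n)], and skew symmetry determines the arrows there from
    the pairs [v < w]. *)
Lemma AF_cvg (u : nat -> AF) (Q : AF) :
  (forall n, \forall m \near \oo, forall v w, (v < w < n)%N ->
    u m v w = Q v w) ->
  u @ \oo --> Q.
Proof.
move=> uQ A; rewrite nbhsE => -[B [[D DB <-] [C DC CQ]] BA].
have [R [V CE]] := DB _ DC; subst C.
pose n := (\max_(i <- V) i).+1%N.
have lt_n v : v \in V -> (v < n)%N.
  by move=> vV; rewrite ltnS; exact: (@leq_bigmax_seq nat (enum_fset V) xpredT id).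
apply: filterS (uQ n) => m um; apply: BA.
exists (AF_basic R V) => // v w vV wV.
rewrite -CQ //; have [vw|wv|->] := ltngtP v w; last by rewrite !arrows_diag.
  by apply: um; rewrite vw lt_n.
by rewrite arrows_skew [RHS]arrows_skew um // wv lt_n.
Qed.

Theorem theorem1p6 (X : countType) (G : quiver X) (hG : is_fraisse G)
    (F : AF) (hF : isomorphic F G) (Q : AF) :
  exists i : nat -> nat,
    (fun m : nat => mutate_seq i m.+1 F) @ \oo --> Q.
Proof.
(* Choice requires a vertex for every pair, so quivers without the extension property get the dummy
   vertex 0. *)
have /choice[x xP] (Pm : AF * nat) : exists x : nat,
    column_extension Pm.1 ->
    (forall v w, (v < w < Pm.2./2)%N -> mutation x Pm.1 v w = Pm.1 v w) /\
    (forall v, (v < Pm.2./2)%N -> mutation x Pm.1 v Pm.2./2 =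
       if odd Pm.2 then Num.min (Pm.1 v Pm.2./2) (Q v Pm.2./2)
       else Num.max (Pm.1 v Pm.2./2) (Q v Pm.2./2)).
  have [ext|next] := pselect (column_extension Pm.1); last by exists 0%N.
  by have [x xP] := mutation_column_step Q _ Pm.2 ext; exists x.
(* Each vertex depends on the current quiver, so the quivers are built first and [i] is read off
   from them. *)
pose st := fix st m := if m is k.+1 then mutation (x (st k, k)) (st k) else F.
pose i m := x (st m, m).
have iE m : mutate_seq i m F = st m by elim: m => //= m ->.
have ext m : column_extension (st m).
  elim: m => [|m IH] /=; last exact: mutation_column_extension.
  exact: isomorphic_fraisse_column_extension hG hF.
(* For odd [m] column [m./2] has just been raised to at least its target, so the minimum taken next
   is exactly [Q]. *)
have stQ m : (forall v w, (v < w < m./2)%N -> st m v w = Q v w) /\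
    (odd m -> forall v, (v < m./2)%N -> Q v m./2 <= st m v m./2).
  elim: m => [|m [IH1 IH2]]; first by split=> // v w; rewrite ltn0 andbF.
  have [old new] := xP (st m, m) (ext m).
  have {}old v w : (v < w < m./2)%N -> st m.+1 v w = Q v w.
    by move=> vw; rewrite -IH1 //; exact: old.
  case: (boolP (odd m)) IH2 => om IH2.
    have mE : m.+1./2 = m./2.+1 by lia.
    split; last by rewrite /= om.
    rewrite mE => v w /andP[vw]; rewrite ltnS leq_eqVlt => /predU1P[wE|wm].
      subst w; rewrite [LHS]new //= om; apply/min_idPr; exact: IH2.
    by apply: old; rewrite vw.
  have mE : m.+1./2 = m./2 by lia.
  rewrite mE; split=> // _ v vm.
  by rewrite [leRHS]new //= (negbTE om) le_max lexx orbT.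
(* Two mutations per column: after [n.*2] of them all columns below [n] are correct. *)
exists i; apply: AF_cvg => n; exists n.*2 => // m /= nm v w vwn.
by rewrite iE; apply: (stQ m.+1).1; lia.
Qed.
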